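(* Consider the multi-agent system $\dot x_i(t)=u_i(t)$, $t\geqslant 0$, $i=1,\dots,N$, $x_i\in\mathbb{R}$, with sampled control input, for $t\in[t_k,t_{k+1})$, $$u_i(t)=\begin{cases}0, & t_k\in\Xi(0,+\infty),\\ \sum_{j=1}^N a_{ij}(x_j(t_k)-x_i(t_k)), & t_k\in\Theta(0,+\infty),\end{cases}$$ where the Laplacian $\mathscr{L}$ is symmetric and irreducible, and $\xi$ is a DoS sequence that is not an edge case. Let $t_1=0$ and $t_{k+1}=t_k+\Delta_k$, where $\Delta_k=\Delta_0$ if $t_k\in[0,h_1+\tau_1)$, with $\Delta_0>0$ satisfying $\lvert 1-\Delta_0\lambda_N(\mathscr{L})\rvert<1$, and $$\Delta_k=\min\left\{\Delta_0,\ \frac{1-\hat B_d(h_n+\tau_n)}{\gamma_1\hat B_f(h_n)}\right\}\quad\text{if } t_k\in[h_n+\tau_n,h_{n+1}+\tau_{n+1}),\ n\in\mathbb{N}_+,$$ with a constant $\gamma_1>1$, where $\hat B_d,\hat B_f$ are generated by the DoS estimator (with any parameters $2\leqslant\ell\in\mathbb{N}_+$, $0<\epsilon_0<1$, $0<\theta<1$). Then the system reaches average consensus, i.e. $\lim_{t\to+\infty}\big(x_i(t)-\frac1N\sum_{j=1}^N x_j(0)\big)=0$ for all $i$, and there exists a constant $\underline{\Delta}>0$ with $\Delta_k\geqslant\underline{\Delta}$ for all $k$.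
   Context: A DoS sequence $\xi=\{H_n\}$ is a finite or infinite sequence of sets $H_n := \{h_n\}\cup[h_n,h_n+\tau_n)$, where $h_1\geqslant 0$, $\tau_n\geqslant 0$ and $h_{n+1} > h_n+\tau_n$ for all $n$. If $\xi$ has only $m$ elements, the convention $h_{n}=h_{n}+\tau_{n}=+\infty$ for $n>m$ is used. For $0\leqslant \tau\leqslant s$ let $\Xi(\tau,s) := \bigcup_n H_n\cap[\tau,s]$ (times under attack, where transmissions fail), $\Theta(\tau,s):=[\tau,s]\setminus\Xi(\tau,s)$, and $n_\xi(\tau,s) := \operatorname{card}(\{h_n\}_n\cap[\tau,s])$; $\lvert\cdot\rvert$ denotes Lebesgue measure; $\Xi(0,+\infty)=\bigcup_n H_n$, $\Theta(0,+\infty)=[0,+\infty)\setminus\Xi(0,+\infty)$. A constant $B_d\in[0,1]$ is a duration-bound of $\xi$ if there is $0<\kappa<+\infty$ with $\lvert \Xi(0,t)\rvert\leqslant \kappa + B_d t$ for all $t\geqslant 0$. A constant $B_f\in[0,+\infty)$ is a frequency-bound of $\xi$ if there is an integer $0<\Lambda<+\infty$ with $n_\xi(0,t)\leqslant \Lambda + B_f t$ for all $t\geqslant 0$; if no such finite $B_f$ exists, the frequency-bound is $+\infty$. $\mathcal{D}(\xi)$, $\mathcal{F}(\xi)$ are the sets of duration- and frequency-bounds. $\xi$ is an edge case if (i) $\inf\mathcal{D}(\xi)=1$, or (ii) $\inf\mathcal{F}(\xi)=+\infty$, or (iii) for every $\Gamma>0$ there is $n$ with $\tau_n>\Gamma$.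 DoS estimator: with $B_d(i) := \frac{\lvert \Xi(0,h_i+\tau_i)\rvert}{h_i+\tau_i}$ and $B_f(i) := \frac{i}{h_i}$, $\hat B_d(t) = \epsilon_0$ for $t\in[0,h_\ell+\tau_\ell)$, $\hat B_d(t) = \max_{\ell\leqslant i\leqslant n}\{\epsilon_0,\ \theta B_d(i)+(1-\theta)\}$ for $t\in[h_n+\tau_n, h_{n+1}+\tau_{n+1})$, $n\geqslant \ell$; $\hat B_f(t) = \epsilon_0$ for $t\in[0,h_\ell)$, $\hat B_f(t) = \max_{\ell\leqslant i\leqslant n}\{\epsilon_0,\ B_f(i)/\theta\}$ for $t\in[h_n,h_{n+1})$, $n\geqslant\ell$. Network: $a_{ij}\in\{0,1\}$, $a_{ij}=1$ iff agents $i,j$ are connected; Laplacian $\mathscr{L}=(l_{ij})$ with $l_{ij}=-a_{ij}$ ($i\neq j$), $l_{ii}=\sum_{j\neq i}a_{ij}$. Under symmetry and irreducibility its eigenvalues are $0=\lambda_1(\mathscr{L})<\lambda_2(\mathscr{L})\leqslant\cdots\leqslant\lambda_N(\mathscr{L})$. *)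

(* Defs.v *)
From HB Require Import structures.
From mathcomp Require Import all_boot all_order all_algebra.
From mathcomp Require Import all_classical all_reals all_analysis.
Set Implicit Arguments. Unset Strict Implicit. Unset Printing Implicit Defensive.
Import Order.TTheory GRing.Theory Num.Theory.
Import numFieldNormedType.Exports.
Local Open Scope classical_set_scope.
Local Open Scope ring_scope.

Section Defs.
Variable R : realType.

(* ---------- DoS sequences ----------
   A DoS sequence is given by its length [m] (None = infinite, Some m = m
   elements) and 1-indexed sequences [h], [tau]; only the indices
   n with [dos_idx m n] (1 <= n, and n <= m if finite) are meaningful.
   H_n = {h_n} ∪ [h_n, h_n + tau_n). *)
Definition dos_idx (m : option nat) (n : nat) : bool :=
  (1 <= n)%N && (if m is Some m' then (n <= m')%N else true).

Definition is_DoS (m : option nat) (h tau : nat -> R) : Prop :=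
  (dos_idx m 1 -> 0 <= h 1%N) /\
  (forall n, dos_idx m n -> 0 <= tau n) /\
  (forall n, dos_idx m n -> dos_idx m n.+1 -> h n + tau n < h n.+1).

Definition attack_set (m : option nat) (h tau : nat -> R) : set R :=
  [set s | exists n, dos_idx m n /\ (s = h n \/ (h n <= s /\ s < h n + tau n))].

Definition Xi (m : option nat) (h tau : nat -> R) (a b : R) : set R :=
  attack_set m h tau `&` `[a, b].

(* card({h_n}_n ∩ [a,b]) <= c, written literally: every finite duplicate-free
   list of elements of {h_n}_n ∩ [a,b] has length <= c *)
Definition n_xi_le (m : option nat) (h tau : nat -> R) (a b c : R) : Prop :=
  forall s : seq R, uniq s ->
    (forall x, x \in s -> exists n, dos_idx m n /\ h n = x /\ a <= x <= b) ->
    (size s)%:R <= c.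

Definition duration_bounds (m : option nat) (h tau : nat -> R) : set R :=
  [set Bd | 0 <= Bd <= 1 /\ exists kappa : R, 0 < kappa /\
     forall t, 0 <= t ->
       (lebesgue_measure (Xi m h tau 0 t) <= (kappa + Bd * t)%:E)%E].

Definition freq_bounds (m : option nat) (h tau : nat -> R) : set R :=
  [set Bf | 0 <= Bf /\ exists Lambda : nat, (0 < Lambda)%N /\
     forall t, 0 <= t -> n_xi_le m h tau 0 t (Lambda%:R + Bf * t)].

(* edge case; the frequency bound is +oo exactly when there is no finite
   one, so inf F(xi) = +oo is expressed with the extended-real infimum of
   the finite frequency-bounds *)
Definition edge_case (m : option nat) (h tau : nat -> R) : Prop :=
  inf (duration_bounds m h tau) = 1 \/
  ereal_inf (EFin @` freq_bounds m h tau) = +oo%E \/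
  (forall Gamma : R, 0 < Gamma -> exists n, dos_idx m n /\ Gamma < tau n).

Definition Bd_i (m : option nat) (h tau : nat -> R) (i : nat) : R :=
  fine (lebesgue_measure (Xi m h tau 0 (h i + tau i))) / (h i + tau i).

Definition Bf_i (h : nat -> R) (i : nat) : R := i%:R / h i.

Definition Bd_hat_at (m : option nat) (h tau : nat -> R) (ell : nat)
  (eps0 theta : R) (n : nat) : R :=
  \big[Num.max/eps0]_(ell <= i < n.+1) (theta * Bd_i m h tau i + (1 - theta)).

Definition Bf_hat_at (h : nat -> R) (ell : nat) (eps0 theta : R) (n : nat) : R :=
  \big[Num.max/eps0]_(ell <= i < n.+1) (Bf_i h i / theta).

(* end point h_n + tau_n of H_n, with the +oo convention for n > m,
   and the conventional value 0 for n = 0 (start of [0, h_1 + tau_1)) *)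
Definition dos_end (m : option nat) (h tau : nat -> R) (n : nat) : \bar R :=
  if n is 0 then 0%E else
  if dos_idx m n then (h n + tau n)%:E else +oo%E.

Definition in_phase (m : option nat) (h tau : nat -> R) (n : nat) (s : R) : Prop :=
  (dos_end m h tau n <= s%:E)%E /\ (s%:E < dos_end m h tau n.+1)%E.

Definition laplacian (N : nat) (a : 'I_N -> 'I_N -> bool) : 'M[R]_N :=
  \matrix_(i, j) (if i == j then \sum_(k < N | k != i) (a i k)%:R
                  else - (a i j)%:R).

Definition mx_irreducible (N : nat) (A : 'M[R]_N) : Prop :=
  forall S : {set 'I_N}, S != finset.set0 -> S != finset.setTfor 'I_N ->
    exists i j, [/\ i \in S, j \notin S & A i j != 0].

End Defs.

(* Main.v *)
(* A successful sample with step s replaces the disagreement vector y by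
   y - s y L, which is a uniform contraction for s bounded below and at most
   Delta0; so consensus amounts to having infinitely many successful samples.
   If all late samples were attacked, every step of length Delta_k would leap
   over at least one gap between consecutive attacks, hence the attack-free
   time before the j-th attack would be at most C + r j inf_k Delta_k, with r
   as close to 1 as desired.  The estimator makes Delta_k at most
   (theta^2 / gamma1) F_j / j eventually, where F_j is that free time, so F_j is
   at least (gamma1 / theta^2) j inf_k Delta_k: a contradiction for large j. *)
Require Import Defs.
From HB Require Import structures.
From mathcomp Require Import all_boot all_order all_algebra.
From mathcomp Require Import all_classical all_reals all_analysis.
From mathcomp Require Import ring lra.
Import Order.TTheory GRing.Theory Num.Theory.
Import numFieldNormedType.Exports.
Local Open Scope classical_set_scope.
Local Open Scope ring_scope.
Set Implicit Arguments.
Unset Strict Implicit.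

(** * Quadratic forms of real symmetric matrices *)

Section SymmetricMatrices.
Variables (R : realType) (n : nat).
Implicit Types (u v w : 'rV[R]_n) (A : 'M[R]_n).

Definition dotp u v : R := (u *m v^T) 0 0.

Lemma dotpE u v : dotp u v = \sum_i u 0 i * v 0 i.
Proof. by rewrite /dotp mxE; apply: eq_bigr => i _; rewrite mxE. Qed.

Lemma dotpC u v : dotp u v = dotp v u.
Proof. by rewrite !dotpE; apply: eq_bigr => i _; rewrite mulrC. Qed.

Lemma dotpDl u v w : dotp (u + v) w = dotp u w + dotp v w.
Proof. by rewrite /dotp mulmxDl mxE. Qed.

Lemma dotpZl c u v : dotp (c *: u) v = c * dotp u v.
Proof. by rewrite /dotp -scalemxAl mxE. Qed.

Lemma dotpDr u v w : dotp u (v + w) = dotp u v + dotp u w.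
Proof. by rewrite dotpC dotpDl !(dotpC u). Qed.

Lemma dotpZr c u v : dotp u (c *: v) = c * dotp u v.
Proof. by rewrite dotpC dotpZl (dotpC u). Qed.

Lemma dotp_ge0 u : 0 <= dotp u u.
Proof. by rewrite dotpE; apply: sumr_ge0 => i _; exact: sqr_ge0. Qed.

Lemma sqr_coord_le u i : u 0 i ^+ 2 <= dotp u u.
Proof.
rewrite dotpE (bigD1 i)//= expr2 lerDl.
by apply: sumr_ge0 => j _; exact: sqr_ge0.
Qed.

Lemma dotp_eq0 u : dotp u u = 0 -> u = 0.
Proof.
move=> u0; apply/rowP => i; rewrite mxE; apply/eqP.
by rewrite -sqrf_eq0 eq_le sqr_ge0 andbT -u0 sqr_coord_le.
Qed.

Lemma dotp_sym A u v : A^T = A -> dotp (u *m A) v = dotp (v *m A) u.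
Proof. by move=> sA; rewrite dotpC /dotp trmx_mul sA mulmxA. Qed.

Lemma continuous_quad A : continuous (fun v => dotp (v *m A) v).
Proof.
have -> : (fun v => dotp (v *m A) v) =
    (fun v => \sum_i (\sum_j v 0 j * A j i) * v 0 i).
  by apply/funext => v; rewrite dotpE; apply: eq_bigr => i _; rewrite mxE.
apply: continuous_big => [|i _ v]; first exact: add_continuous.
apply: continuousM; last exact: coord_continuous.
move: v; apply: continuous_big => [|j _ v]; first exact: add_continuous.
by apply: continuousM; [exact: coord_continuous|exact: cst_continuous].
Qed.

Lemma unit_sphere_compact : compact [set v : 'rV[R]_n | dotp v v = 1].
Proof.
apply: bounded_closed_compact.
  exists 1; split; first by rewrite num_real.
  move=> M M1 v /= v1.
  rewrite [`|v|]mx_normrE; apply/bigmax_leP; split; first by rewrite ltW// (lt_trans _ M1).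
  move=> [i j] _ /=; rewrite ord1 (le_trans _ (ltW M1))//.
  rewrite -(@ler_pXn2r _ 2)// ?nnegrE// expr1n real_normK ?num_real//.
  by rewrite -v1 sqr_coord_le.
have -> : [set v | dotp v v = 1] = (fun v => dotp (v *m 1%:M) v) @^-1` [set 1].
  by apply/seteqP; split => v /=; rewrite mulmx1.
apply: preimage_closed; last exact: closed_eq.
by move=> v _; exact: continuous_quad.
Qed.

(** With [z = v *m A], the form at [v - s *: z] is [s * (s * dotp (z *m A) z - 2 * dotp z z)], which
    is negative for small [s > 0] unless [z = 0]. *)
Lemma psd_null_vector A v : A^T = A -> (forall w, 0 <= dotp (w *m A) w) ->
  dotp (v *m A) v = 0 -> v *m A = 0.
Proof.
move=> sA psd v0; apply: dotp_eq0; set z := v *m A.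
have zz0 := dotp_ge0 z; have zA0 := psd z.
have K s : 0 <= s * (s * dotp (z *m A) z - 2 * dotp z z).
  suff -> : s * (s * dotp (z *m A) z - 2 * dotp z z) =
      dotp ((v - s *: z) *m A) (v - s *: z) by exact: psd.
  rewrite mulmxBl -scalemxAl -!(scaleNr s) !(dotpDl, dotpDr, dotpZl, dotpZr) v0.
  by rewrite (dotp_sym z v sA) -/z; ring.
apply/eqP; rewrite eq_le zz0 andbT leNgt; apply/negP => zz.
(* Adding 1 keeps the denominator of the chosen [s] positive even if [dotp (z *m A) z] vanishes. *)
have p1 : 0 < dotp (z *m A) z + 1 by lra.
have := K (dotp z z / (dotp (z *m A) z + 1)).
rewrite pmulr_rge0 ?divr_gt0// leNgt => /negP; apply.
rewrite mulrAC subr_lt0 ltr_pdivrMr//; nra.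
Qed.

(* The maximum of the quadratic form on the unit sphere is attained at an
   eigenvector, so it is at most the largest eigenvalue. *)
Lemma quad_le_eigenvalue A lam : A^T = A ->
  (forall mu, eigenvalue A mu -> mu <= lam) ->
  forall v, dotp (v *m A) v <= lam * dotp v v.
Proof.
move=> sA maxlam v.
have [->|v0] := eqVneq v 0.
  by rewrite mul0mx !dotpE !big1 ?mulr0// => i _; rewrite mxE mulr0.
have dpos w : w != 0 -> 0 < dotp w w.
  by move=> w0; rewrite lt_def dotp_ge0 andbT; apply: contra_neq w0; exact: dotp_eq0.
pose nrm w := (Num.sqrt (dotp w w))^-1 *: w.
have nrm2 w : (Num.sqrt (dotp w w))^-1 * (Num.sqrt (dotp w w))^-1 = (dotp w w)^-1.
  by rewrite -invfM -expr2 sqr_sqrtr// dotp_ge0.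
have nrm1 w : w != 0 -> dotp (nrm w) (nrm w) = 1.
  by move=> w0; rewrite dotpZl dotpZr mulrA nrm2 mulVf// gt_eqF// dpos.
have [u /= u1 umax] := @EVT_max_rV R n (fun v => dotp (v *m A) v) _
  (ex_intro _ (nrm v) (nrm1 v v0)) unit_sphere_compact
  (continuous_subspaceT (@continuous_quad A)).
rewrite inE/= in u1.
set M := dotp (u *m A) u in umax.
have Mle w : dotp (w *m A) w <= M * dotp w w.
  have [->|w0] := eqVneq w 0.
    by rewrite mul0mx !dotpE !big1 ?mulr0// => i _; rewrite mxE mulr0.
  have := umax (nrm w); rewrite inE/= => /(_ (nrm1 w w0)).
  rewrite -scalemxAl dotpZl dotpZr mulrA nrm2 mulrC ler_pdivrMr//.
  exact: dpos.
apply: (le_trans (Mle v)); rewrite ler_wpM2r ?dotp_ge0//.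
apply: maxlam; apply/eigenvalueP; exists u; last first.
  apply/eqP => u0; move: u1; rewrite u0 dotpE big1 => [/esym/eqP|i _].
    by rewrite oner_eq0.
  by rewrite mxE mulr0.
have E w : w *m (M%:M - A) = M *: w - w *m A by rewrite mulmxBr mul_mx_scalar.
(* [M%:M - A] is positive semidefinite by maximality and its form vanishes at [u], so [u] lies in
   its kernel. *)
have : u *m (M%:M - A) = 0.
  apply: psd_null_vector.
  - by rewrite linearB/= tr_scalar_mx sA.
  - by move=> w; rewrite E -scaleN1r dotpDl !dotpZl mulN1r subr_ge0.
  - by rewrite E -scaleN1r dotpDl !dotpZl mulN1r u1 mulr1 -/M subrr.
by rewrite E => /eqP; rewrite subr_eq0 => /eqP.
Qed.

(** The form is nonnegative at [v - lam^-1 *: (v *m A)]; bounding its second-order term by the upper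
    bound at [v *m A] leaves exactly this inequality. *)
Lemma psd_sqr_le A lam : A^T = A -> 0 < lam ->
  (forall v, 0 <= dotp (v *m A) v <= lam * dotp v v) ->
  forall v, dotp (v *m A) (v *m A) <= lam * dotp (v *m A) v.
Proof.
move=> sA lam0 bA v; set z := v *m A.
have /andP[+ _] := bA (v - lam^-1 *: z); have /andP[_ zz] := bA z.
rewrite mulmxBl -scalemxAl -!(scaleNr lam^-1) !(dotpDl, dotpDr, dotpZl, dotpZr).
rewrite (dotp_sym z v sA) -/z => H.
rewrite -ler_pdivrMl//.
have : lam^-1 * (lam^-1 * dotp (z *m A) z) <= lam^-1 * dotp z z.
  by rewrite ler_pM2l ?invr_gt0// ler_pdivrMl.
by move: H; nra.
Qed.

End SymmetricMatrices.

(** * Graph Laplacians: Poincare inequality and contraction *)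

Section Laplacians.
Variables (R : realType) (N : nat) (a : 'I_N -> 'I_N -> bool).
Hypothesis a_sym : forall i j, a i j = a j i.
Implicit Types y : 'rV[R]_N.

Lemma laplacian_tr : (laplacian R a)^T = laplacian R a.
Proof.
apply/matrixP => i j; rewrite !mxE eq_sym a_sym.
by case: eqVneq => [->|].
Qed.

Lemma mul_laplacian y i :
  (y *m laplacian R a) 0 i = - \sum_j (a i j)%:R * (y 0 j - y 0 i).
Proof.
rewrite mxE (bigD1 i)//= [in RHS](bigD1 i)//= subrr mulr0 add0r !mxE eqxx.
rewrite mulr_sumr -sumrN -big_split/=; apply: eq_bigr => j ji.
by rewrite mxE (negbTE ji) (a_sym j i); ring.
Qed.

(** By symmetry the sum pairs [y] with the image of the constant vector, which is zero. This is why
    a step preserves the average. *)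
Lemma sum_mul_laplacian y : \sum_i (y *m laplacian R a) 0 i = 0.
Proof.
pose one : 'rV[R]_N := const_mx 1.
have -> : \sum_i (y *m laplacian R a) 0 i = dotp (y *m laplacian R a) one.
  by rewrite dotpE; apply: eq_bigr => i _; rewrite [one _ _]mxE mulr1.
rewrite (dotp_sym _ _ laplacian_tr) dotpE big1// => i _.
rewrite mul_laplacian big1 ?oppr0 ?mul0r// => j _.
by rewrite !mxE subrr mulr0.
Qed.

Lemma quad_laplacian y : 2 * dotp (y *m laplacian R a) y =
  \sum_i \sum_j (a i j)%:R * (y 0 i - y 0 j) ^+ 2.
Proof.
have E : dotp (y *m laplacian R a) y =
    \sum_i \sum_j (a i j)%:R * ((y 0 i - y 0 j) * y 0 i).
  rewrite dotpE; apply: eq_bigr => i _; rewrite mul_laplacian mulNr mulr_suml.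
  by rewrite -sumrN; apply: eq_bigr => j _; ring.
(* Exchanging the two indices gives a second expression; adding it to the first completes the
   square. *)
have E' : dotp (y *m laplacian R a) y =
    \sum_i \sum_j (a i j)%:R * ((y 0 j - y 0 i) * y 0 j).
  rewrite E exchange_big/=; apply: eq_bigr => i _; apply: eq_bigr => j _.
  by rewrite a_sym.
rewrite mulr2n mulrDl mul1r {1}E E' -big_split/=; apply: eq_bigr => i _.
by rewrite -big_split/=; apply: eq_bigr => j _; ring.
Qed.

Lemma quad_laplacian_ge0 y : 0 <= dotp (y *m laplacian R a) y.
Proof.
rewrite -(pmulr_rge0 _ (ltr0Sn R 1)) quad_laplacian.
apply: sumr_ge0 => i _; apply: sumr_ge0 => j _.
by rewrite mulr_ge0// sqr_ge0.
Qed.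

Lemma edge_le_quad y i j : a i j ->
  (y 0 i - y 0 j) ^+ 2 <= 2 * dotp (y *m laplacian R a) y.
Proof.
move=> aij; rewrite quad_laplacian (bigD1 i)//= (bigD1 j)//= aij mul1r -addrA lerDl.
apply: addr_ge0; first by apply: sumr_ge0 => k _; rewrite mulr_ge0// sqr_ge0.
by apply: sumr_ge0 => k _; apply: sumr_ge0 => l _; rewrite mulr_ge0// sqr_ge0.
Qed.

Hypothesis a_irr : mx_irreducible (laplacian R a).

(** No edge leaves the set of vertices reachable from [i], so irreducibility makes it the whole
    vertex set. *)
Lemma irreducible_connect i j : connect a i j.
Proof.
pose S : {set 'I_N} := [set k | connect a i k]%SET.
have S0 : S != finset.set0.
  by apply/set0Pn; exists i; rewrite finset.inE connect0.
have [ST|SnT] := eqVneq S finset.setT.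
  by have : j \in S; [rewrite ST finset.inE|rewrite finset.inE].
have [k [l []]] := a_irr S0 SnT.
rewrite !finset.inE => ik il; rewrite mxE.
case: (eqVneq k l) => [kl|kl]; first by rewrite -kl ik in il.
case akl: (a k l); last by rewrite oppr0 eqxx.
by move: il; rewrite (connect_trans ik)// connect1.
Qed.

(** Induction along a path from [i] to [j]. Each edge costs at most twice the form, and
    [(u - w)^2 <= 2 (u - v)^2 + 2 (v - w)^2] turns [C] into [4 + 2 * C]. *)
Lemma coord_diff_le_quad i j : exists2 C : R, 0 <= C &
  forall y, (y 0 i - y 0 j) ^+ 2 <= C * dotp (y *m laplacian R a) y.
Proof.
have /connectP[p + ->] := irreducible_connect i j.
elim: p i => [|k p IH] i /=.
  by move=> _; exists 0 => // y; rewrite subrr expr0n mul0r.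
move=> /andP[aik /IH[C C0 HC]]; exists (4 + 2 * C) => [|y]; first by nra.
have := HC y; have := edge_le_quad y aik.
set u := y 0 i; set v := y 0 k; set w := y 0 _; set q := dotp _ _.
have : 0 <= (u - v - (v - w)) ^+ 2 by exact: sqr_ge0.
rewrite !expr2; nra.
Qed.

(** For a vector of zero sum, the squared differences over all ordered pairs add up to
    [2 * N%:R * dotp y y], and each of them is controlled by the form. *)
Lemma poincare : exists2 c : R, 0 < c & forall y, \sum_i y 0 i = 0 ->
  c * dotp y y <= dotp (y *m laplacian R a) y.
Proof.
have /fin_all_exists2[C C0 HC] ij := coord_diff_le_quad ij.1 ij.2.
have S0 : 0 <= \sum_ij C ij by exact: sumr_ge0.
exists (1 + \sum_ij C ij)^-1 => [|y y0]; first by rewrite invr_gt0; lra.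
rewrite mulrC ler_pdivrMr; last lra.
have q0 := quad_laplacian_ge0 y.
have : \sum_(ij : 'I_N * 'I_N) (y 0 ij.1 - y 0 ij.2) ^+ 2 <=
    (\sum_ij C ij) * dotp (y *m laplacian R a) y.
  by rewrite mulr_suml; apply: ler_sum => ij _; exact: HC.
rewrite -(pair_bigA _ (fun i j => (y 0 i - y 0 j) ^+ 2))/=.
have -> : \sum_i \sum_j (y 0 i - y 0 j) ^+ 2 = 2 * N%:R * dotp y y.
  have -> : \sum_i \sum_j (y 0 i - y 0 j) ^+ 2 =
      \sum_i (N%:R * y 0 i ^+ 2 + dotp y y).
    apply: eq_bigr => i _.
    under eq_bigr do rewrite sqrrB.
    rewrite big_split big_split/= sumrN sumr_const card_ord sumrMnl -mulr_sumr y0.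
    by rewrite mulr0 mul0rn subr0 -(mulr_natl (y 0 i ^+ 2)) dotpE.
  rewrite big_split/= -mulr_sumr sumr_const card_ord -mulr_natl.
  have -> : \sum_i y 0 i ^+ 2 = dotp y y by rewrite dotpE.
  by ring.
have [N0|Npos] := posnP N.
  move=> _; have -> : dotp y y = 0 by rewrite dotpE big1// => i; have := ltn_ord i; rewrite {2}N0.
  by rewrite mulr_ge0//; lra.
have N1 : (1 : R) <= N%:R by rewrite ler1n.
have := dotp_ge0 y; nra.
Qed.

(* With mu the largest eigenvalue, |y - s y L|^2 <= |y|^2 - s (2 - s mu) y L y^T,
   and the quadratic form is bounded below by the Poincare inequality. *)
Lemma laplacian_contraction (Delta0 lamN : R) :
  (forall mu, eigenvalue (laplacian R a) mu -> mu <= lamN) ->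
  0 < Delta0 -> `|1 - Delta0 * lamN| < 1 ->
  exists2 c : R, 0 < c & forall y s, \sum_i y 0 i = 0 -> 0 <= s <= Delta0 ->
    let z := y - s *: (y *m laplacian R a) in
    dotp z z <= (1 - c * s) * dotp y y.
Proof.
move=> lam_max D0; rewrite ltr_norml => /andP[Hl Hr].
have lam0 : 0 < lamN by rewrite -(pmulr_rgt0 _ D0); lra.
have [c c0 Hc] := poincare.
(* The step condition says [0 < Delta0 * lamN < 2], so this constant is positive. *)
exists (c * (2 - Delta0 * lamN)) => [|y s ysum /andP[s0 sD]]; first by rewrite mulr_gt0//; lra.
have qb v : 0 <= dotp (v *m laplacian R a) v <= lamN * dotp v v.
  by rewrite quad_laplacian_ge0 (quad_le_eigenvalue laplacian_tr).
have := psd_sqr_le laplacian_tr lam0 qb y; have := Hc y ysum.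
have := dotp_ge0 y.
rewrite /= -scaleNr !(dotpDl, dotpDr, dotpZl, dotpZr).
rewrite (dotpC y (y *m _)).
set q := dotp (y *m _) y; set w := dotp (y *m _) (y *m _); set V := dotp y y.
move=> V0 cV wq.
have h1 : s * (s * w) <= s * (s * (lamN * q)) by rewrite !ler_wpM2l.
have sl : s * lamN <= Delta0 * lamN by rewrite ler_pM2r.
have q0 : 0 <= q by exact: quad_laplacian_ge0.
have h2 : s * (s * lamN * q) <= s * (Delta0 * lamN * q).
  by rewrite ler_wpM2l// ler_wpM2r.
have h3 : (s * (2 - Delta0 * lamN)) * (c * V) <= (s * (2 - Delta0 * lamN)) * q.
  by rewrite ler_wpM2l// mulr_ge0//; lra.
lra.
Qed.

End Laplacians.

(** * Attacks: order, measure, frequency and phases *)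

Section DoS_sequences.
Variables (R : realType) (m : option nat) (h tau : nat -> R).
Hypothesis dos : is_DoS m h tau.
Local Notation mu := (@lebesgue_measure R).

Lemma dos_idxW i j : dos_idx m j -> (0 < i <= j)%N -> dos_idx m i.
Proof.
rewrite /dos_idx => /andP[_ jm] /andP[-> ij] /=.
by case: m jm => // m'; exact: leq_trans.
Qed.

Lemma dos_end_lt i j : dos_idx m j -> (0 < i < j)%N -> h i + tau i < h j.
Proof.
have [_ [tau0 hS]] := dos.
elim: j => [|j IH] Hj /andP[i0 ij]; first by [].
have jpos : (0 < j)%N by exact: leq_trans i0 _.
have Hj' : dos_idx m j by apply: dos_idxW Hj _; rewrite jpos/=.
move: ij; rewrite ltnS leq_eqVlt => /predU1P[->|ij]; first exact: hS.
have := IH Hj'; rewrite i0 ij => /(_ isT) /lt_trans; apply.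
by rewrite (le_lt_trans _ (hS _ Hj' Hj))// lerDl tau0.
Qed.

Lemma tau_ge0 n : dos_idx m n -> 0 <= tau n.
Proof. by have [_ [+ _]] := dos; exact. Qed.

Lemma h_lt i j : dos_idx m j -> (0 < i < j)%N -> h i < h j.
Proof.
move=> Hj /[dup] /andP[i0 ij] /(dos_end_lt Hj); apply: le_lt_trans.
by rewrite lerDl tau_ge0//; apply: dos_idxW Hj _; rewrite i0 ltnW.
Qed.

Lemma h_le i j : dos_idx m j -> (0 < i <= j)%N -> h i <= h j.
Proof.
move=> Hj /andP[i0]; rewrite leq_eqVlt => /predU1P[->//|ij].
by rewrite ltW// h_lt// i0.
Qed.

Lemma dos_end_le i j : dos_idx m j -> (0 < i <= j)%N -> h i + tau i <= h j + tau j.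
Proof.
move=> Hj /andP[i0]; rewrite leq_eqVlt => /predU1P[->//|ij].
by rewrite ltW// ltr_wpDr ?tau_ge0// dos_end_lt// i0.
Qed.

Lemma h_ge0 n : dos_idx m n -> 0 <= h n.
Proof.
move=> Hn; have n0 : (0 < n)%N by case/andP: Hn.
apply: le_trans (h_le (i := 1) Hn _); last by rewrite n0.
by apply: dos.1; apply: dos_idxW Hn _.
Qed.

Lemma h_gt0 n : (2 <= n)%N -> dos_idx m n -> 0 < h n.
Proof.
move=> n2 Hn; apply: le_lt_trans (h_lt (i := 1) Hn _); last by rewrite n2.
by apply: h_ge0; apply: dos_idxW Hn _; rewrite (ltnW n2).
Qed.

Lemma measurable_attack_set : measurable (attack_set m h tau).
Proof.
have -> : attack_set m h tau =
    \bigcup_(n in dos_idx m) ([set h n] `|` `[h n, h n + tau n[%classic).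
  apply/seteqP; split => s /=.
    by move=> [n [mn [->|/andP ?]]]; exists n => //; [left|right; rewrite /= in_itv].
  move=> [n mn [->|/=]]; first by exists n; split => //; left.
  by rewrite in_itv/= => /andP ?; exists n; split => //; right.
by apply: bigcup_measurable => n _; apply: measurableU; [exact: measurable_set1|exact: measurable_itv].
Qed.

Lemma measurable_Xi b : measurable (Xi m h tau 0 b).
Proof. by apply: measurableI => //; exact: measurable_attack_set. Qed.

Lemma Xi_le b : 0 <= b -> (mu (Xi m h tau 0 b) <= b%:E)%E.
Proof.
move=> b0; have -> : b%:E = mu `[0, b]%classic.
  rewrite lebesgue_measure_itv/= lte_fin; case: ltP; first by rewrite oppr0 adde0.
  by move=> b0'; congr (_%:E); apply/eqP; rewrite eq_le b0 b0'.
apply: le_measure => //; rewrite ?inE//; first exact: measurable_Xi.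
by move=> x [].
Qed.

Lemma fine_Xi b : 0 <= b -> (fine (mu (Xi m h tau 0 b)))%:E = mu (Xi m h tau 0 b).
Proof.
move=> b0; rewrite fineK// ge0_fin_numE//.
by apply: le_lt_trans (Xi_le b0) _; exact: ltry.
Qed.

(** [A] and the interval of the [n]-th attack are disjoint parts of the attacked set, so their
    measures add. *)
Lemma Xi_ge_tau A n : measurable A -> dos_idx m n ->
  A `<=` Xi m h tau 0 (h n + tau n) -> A `&` `[h n, h n + tau n[ = set0 ->
  fine (mu A) + tau n <= fine (mu (Xi m h tau 0 (h n + tau n))).
Proof.
move=> mA Hn AX AI.
have t0 := tau_ge0 Hn; have h0 := h_ge0 Hn.
have b0 : 0 <= h n + tau n by rewrite addr_ge0.
have muI : (tau n)%:E = mu `[h n, h n + tau n[%classic.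
  rewrite lebesgue_measure_itv/= lte_fin ltrDl; case: ltP => [_|t0'].
    by rewrite -EFinD addrAC subrr add0r.
  by congr (_%:E); apply/eqP; rewrite eq_le t0 t0'.
have Afin : mu A \is a fin_num.
  rewrite ge0_fin_numE//; apply: (@le_lt_trans _ _ (mu (Xi m h tau 0 (h n + tau n)))).
    by apply: le_measure => //; rewrite ?inE//; exact: measurable_Xi.
  by rewrite -fine_Xi// ltry.
rewrite -lee_fin fine_Xi// EFinD fineK// muI -measureU//.
apply: le_measure; rewrite ?inE; last 1 first.
- move=> s [/AX//|/=]; rewrite in_itv/= => /andP[hs sh]; split.
    by exists n; split => //; right.
  by rewrite /= in_itv/= (le_trans h0 hs) ltW.
- by apply: measurableU => //; exact: measurable_itv.
- exact: measurable_Xi.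
Qed.

Lemma sum_tau_le_Xi n : dos_idx m n ->
  \sum_(1 <= i < n.+1) tau i <= fine (mu (Xi m h tau 0 (h n + tau n))).
Proof.
elim: n => [//|[|n] IH] Hn.
  rewrite big_nat1; apply: le_trans (Xi_ge_tau measurable0 Hn _ (set0I _)) => //.
  by rewrite measure0 add0r.
have Hn' : dos_idx m n.+1 by apply: dos_idxW Hn _; rewrite /= leqnSn.
have lt : h n.+1 + tau n.+1 < h n.+2 by apply: dos_end_lt; rewrite //= ltnSn.
(* Here [A] is the attacked set up to the end of the previous attack. *)
rewrite big_nat_recr//=; apply: le_trans (Xi_ge_tau (measurable_Xi (h n.+1 + tau n.+1)) Hn _ _).
- by rewrite lerD2r; exact: IH.
- move=> s [As]; rewrite /= !in_itv/= => /andP[s0 sb]; split => //=.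
  by rewrite in_itv/= s0 (le_trans sb)// (le_trans (ltW lt))// lerDl tau_ge0.
- apply/seteqP; split => // s [[_]]; rewrite /= !in_itv/= => /andP[_ sb] /andP[hs _].
  by move: (le_lt_trans sb (lt_le_trans lt hs)); rewrite ltxx.
Qed.

(* The gap between the first two attacks is free. *)
Lemma Xi_le_gap n : (2 <= n)%N -> dos_idx m n ->
  fine (mu (Xi m h tau 0 (h n + tau n))) <= h n + tau n - (h 2 - (h 1 + tau 1)).
Proof.
move=> n2 Hn; have b0 : 0 <= h n + tau n by rewrite addr_ge0 ?h_ge0 ?tau_ge0.
have H1 : dos_idx m 1 by apply: dos_idxW Hn _; rewrite (ltnW n2).
have H2 : dos_idx m 2 by apply: dos_idxW Hn _.
have e0 : 0 <= h 1 + tau 1 by rewrite addr_ge0 ?h_ge0 ?tau_ge0.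
have e2 : h 2 <= h n + tau n by rewrite ler_wpDr ?tau_ge0// h_le.
have e1 : h 1 + tau 1 < h 2 by exact: dos_end_lt.
rewrite -lee_fin fine_Xi//.
(* The first attack ends by [h 1 + tau 1] and all others start at [h 2] or later. *)
apply: (@le_trans _ _ (mu (`[0%R, h 1 + tau 1]%classic `|` `[h 2, h n + tau n]%classic))).
  apply: le_measure; rewrite ?inE; first exact: measurable_Xi.
    by apply: measurableU.
  move=> s [[i [Hi si]]]; rewrite /= !in_itv/= => /andP[s0 sn].
  have i0 : (0 < i)%N by case/andP: Hi.
  have [i2|] := leqP 2 i.
    right; rewrite sn andbT (le_trans (h_le (i := 2) Hi _))//.
    by case: si => [->//|[]].
  rewrite ltnS leq_eqVlt ltnNge i0 orbF => /eqP i1; left; rewrite s0/=; subst i.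
  by case: si => [->|[_ /ltW//]]; rewrite lerDl tau_ge0.
apply: (@le_trans _ _ (mu `[0%R, (h 1 + tau 1)%R]%classic +
                       mu `[h 2, (h n + tau n)%R]%classic)%E).
  by apply: measureU2; exact: measurable_itv.
rewrite !lebesgue_measure_itv/= !lte_fin.
by case: ltP => ?; case: ltP => ?; rewrite ?oppe0 ?add0e ?adde0 -?EFinB -?EFinD lee_fin; lra.
Qed.

Hypothesis not_edge : ~ edge_case m h tau.

(** 1 is always a duration-bound, so outside the edge case the infimum is strictly below 1 and some
    bound is too. *)
Lemma duration_bound_lt1 : exists B kappa : R, [/\ 0 <= B < 1, 0 < kappa &
  forall b, 0 <= b -> fine (mu (Xi m h tau 0 b)) <= kappa + B * b].
Proof.
have D1 : duration_bounds m h tau 1.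
  split; first by rewrite ler01 lexx.
  exists 1; split => // t t0; apply: le_trans (Xi_le t0) _.
  by rewrite lee_fin mul1r lerDr.
have : inf (duration_bounds m h tau) < 1.
  rewrite lt_neqAle; apply/andP; split.
    by apply/eqP => E; apply: not_edge; left.
  have lb : has_lbound (duration_bounds m h tau) by exists 0 => B [/andP[]].
  exact: (ge_inf lb D1).
move=> /inf_lt[]; first by exists 1.
move=> B [/andP[B0 _] [kappa [k0 HB]]] B1; exists B, kappa; split => //.
  by rewrite B0.
by move=> b b0; rewrite -lee_fin fine_Xi// HB.
Qed.

(** Attacks that end early are handled by the free gap before [h 2], late ones by a duration-bound
    below 1. *)
Lemma Bd_i_le : exists2 c : R, 0 < c &
  forall i, (2 <= i)%N -> dos_idx m i -> Bd_i m h tau i <= 1 - c.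
Proof.
have [B [kappa [/andP[B0 B1] k0 HB]]] := duration_bound_lt1.
case H2 : (dos_idx m 2); last first.
  exists 1 => // i i2 Hi; suff : dos_idx m 2 by rewrite H2.
  exact: dos_idxW Hi _.
have gap0 : 0 < h 2 - (h 1 + tau 1) by rewrite subr_gt0 dos_end_lt.
set c0 := h 2 - _ in gap0.
exists (c0 * (1 - B) / (kappa + c0)) => [|i i2 Hi].
  by rewrite divr_gt0// ?mulr_gt0//; lra.
have T0 : 0 < h i + tau i by rewrite ltr_wpDr ?tau_ge0// h_gt0.
rewrite /Bd_i ler_pdivrMr//.
have := HB _ (ltW T0); have := Xi_le_gap i2 Hi; rewrite -/c0.
set X := fine _; set T := h i + tau i => X1 X2.
have kc : 0 < kappa + c0 by lra.
rewrite -subr_ge0 -(pmulr_rge0 _ kc).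
(* The two bounds on [X] are combined with weights [kappa] and [c0], so that the constant terms
   cancel. *)
have -> : (kappa + c0) * ((1 - c0 * (1 - B) / (kappa + c0)) * T - X) =
   kappa * (T - c0 - X) + c0 * (kappa + B * T - X) by field; lra.
by apply: addr_ge0; apply: mulr_ge0; lra.
Qed.

Lemma card_le_freq : exists (Lambda : nat) (B : R), 0 <= B /\
  forall i s, dos_idx m i -> h i <= s -> i%:R <= Lambda%:R + B * s.
Proof.
have [B [B0 [Lambda [_ HB]]]] : exists B, freq_bounds m h tau B.
  apply: contrapT => /forallNP F0; apply: not_edge; right; left.
  (* The extended infimum of the empty set is [+oo], which is an edge case. *)
  suff -> : freq_bounds m h tau = set0 by rewrite image_set0 ereal_inf0.
  by apply/seteqP; split => // B /F0.
exists Lambda, B; split => // i s Hi his.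
have s0 : 0 <= s by rewrite (le_trans (h_ge0 Hi)).
(* The first [i] attack times are distinct, so they form an admissible list of length [i]. *)
have := HB s s0 [seq h k | k <- iota 1 i]; rewrite size_map size_iota; apply.
  rewrite map_inj_in_uniq ?iota_uniq// => j k; rewrite !mem_iota !add1n !ltnS.
  move=> /andP[j0 ji] /andP[k0 ki] hjk; case: (ltngtP j k) => // jk.
    have Hk : dos_idx m k by apply: dos_idxW Hi _; rewrite k0.
    by have := h_lt (i := j) Hk; rewrite hjk ltxx j0 jk => /(_ isT).
  have Hj : dos_idx m j by apply: dos_idxW Hi _; rewrite j0.
  by have := h_lt (i := k) Hj; rewrite hjk ltxx k0 jk => /(_ isT).
move=> x /mapP[k]; rewrite mem_iota add1n ltnS => /andP[k0 ki] ->.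
have Hk : dos_idx m k by apply: dos_idxW Hi _; rewrite k0.
by exists k; rewrite h_ge0//= (le_trans _ his)// h_le// k0.
Qed.

(** Indices start at 2 because [h 1] may be 0; from then on [Lambda / h i] is at most
    [Lambda / h 2]. *)
Lemma Bf_i_le : exists2 M : R, 0 <= M &
  forall i, (2 <= i)%N -> dos_idx m i -> Bf_i h i <= M.
Proof.
have [Lambda [B [B0 HB]]] := card_le_freq.
case H2 : (dos_idx m 2); last first.
  exists 1 => // i i2 Hi; suff : dos_idx m 2 by rewrite H2.
  exact: dos_idxW Hi _.
have h2 := h_gt0 (leqnn 2) H2.
exists (Lambda%:R / h 2 + B) => [|i i2 Hi].
  by rewrite addr_ge0// divr_ge0// ltW.
rewrite /Bf_i ler_pdivrMr ?h_gt0//; apply: (le_trans (HB _ _ Hi (lexx _))).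
rewrite mulrDl lerD2r mulrAC ler_pdivlMr// ler_wpM2l//.
by rewrite h_le.
Qed.

Lemma in_phase_exists s : 0 <= s -> exists n, in_phase m h tau n s.
Proof.
move=> s0; have ex : exists n, `[< (s%:E < dos_end m h tau n.+1)%E >].
  have [Lambda [B [B0 HB]]] := card_le_freq.
  (* At most [Lambda + B * s] attacks start by time [s], so the attack with the next index, if it
     exists, starts after [s]. *)
  exists (Num.truncn (Lambda%:R + B * s)); apply/asboolP; rewrite /dos_end.
  case: ifPn => [H|_]; last exact: ltry.
  rewrite lte_fin ltr_wpDr ?tau_ge0// ltNge; apply/negP => /(HB _ _ H).
  by apply/negP; rewrite -ltNge truncnS_gt.
have [n /asboolP n1 nmin] := ex_minnP ex.
exists n; split => //; case: n n1 nmin => [|n] _ nmin.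
  by rewrite /= lee_fin.
by rewrite leNgt; apply/negP => lt; have := nmin n (asboolT lt); rewrite ltnn.
Qed.

End DoS_sequences.

Lemma bigmax_nat_le (R : realType) (x : R) (f : nat -> R) (p n : nat) (y : R) : x <= y ->
  (forall i, (p <= i < n)%N -> f i <= y) -> \big[Num.max/x]_(p <= i < n) f i <= y.
Proof. by move=> xy fy; rewrite big_nat; apply: bigmax_le. Qed.

Lemma bigmax_nat_homo (R : realType) (x : R) (f : nat -> R) (p n n' : nat) : (n <= n')%N ->
  \big[Num.max/x]_(p <= i < n) f i <= \big[Num.max/x]_(p <= i < n') f i.
Proof.
move=> nn'; apply: bigmax_nat_le => [|i /andP[pi iN]]; first exact: bigmax_ge_id.
apply: (le_bigmax_seq x i xpredT) => //.
by rewrite mem_index_iota pi (leq_trans iN).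
Qed.

(** * Bounds on the step sizes produced by the estimator *)

Section Sampling.
Variables (R : realType) (m : option nat) (h tau : nat -> R).
Variables (ell : nat) (eps0 theta gamma1 Delta0 : R) (t Delta : nat -> R).
Hypothesis dos : is_DoS m h tau.
Hypothesis not_edge : ~ edge_case m h tau.
Hypothesis ell2 : (2 <= ell)%N.
Hypothesis eps01 : 0 < eps0 < 1.
Hypothesis theta01 : 0 < theta < 1.
Hypothesis gamma1_gt1 : 1 < gamma1.

Let Bdh n := Bd_hat_at m h tau ell eps0 theta n.
Let Bfh n := Bf_hat_at h ell eps0 theta n.

Definition step_bound n : R :=
  (1 - Bd_hat_at m h tau ell eps0 theta n) /
  (gamma1 * Bf_hat_at h ell eps0 theta n).

Let Bfh_gt0 n : 0 < Bfh n.
Proof. by case/andP: eps01 => e0 _; apply: lt_le_trans e0 _; exact: bigmax_ge_id. Qed.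

(** The estimate is a maximum of [eps0 < 1] and of averages of 1 with ratios that stay uniformly
    below 1. *)
Let Bdh_le : exists2 c : R, 0 < c & forall n, dos_idx m n -> Bdh n <= 1 - c.
Proof.
have [c c0 Hc] := Bd_i_le dos not_edge.
have /andP[e0 e1] := eps01; have /andP[th0 th1] := theta01.
exists (Num.min (1 - eps0) (theta * c)) => [|n Hn].
  by rewrite lt_min subr_gt0 e1 mulr_gt0.
apply: bigmax_nat_le => [|i /andP[li]].
  by rewrite lerBrDl -lerBrDr ge_min lexx.
rewrite ltnS => iN; have i2 : (2 <= i)%N by exact: leq_trans li.
have Hi : dos_idx m i by apply: dos_idxW Hn _; rewrite (ltnW i2).
have := Hc i i2 Hi; have : Num.min (1 - eps0) (theta * c) <= theta * c.
  by rewrite ge_min lexx orbT.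
nra.
Qed.

Let Bdh_lt1 n : dos_idx m n -> 0 < 1 - Bdh n.
Proof. by have [c c0 Hc] := Bdh_le => /Hc ?; lra. Qed.

Lemma step_bound_inf : exists2 c : R, 0 < c & forall n, dos_idx m n -> c <= step_bound n.
Proof.
have [c c0 Hc] := Bdh_le; have [M M0 HM] := Bf_i_le dos not_edge.
have /andP[e0 e1] := eps01; have /andP[th0 th1] := theta01.
(* [M / theta] dominates the estimated frequencies and 1 dominates [eps0]. *)
have S0 : 0 < M / theta + 1 by rewrite ltr_wpDl// divr_ge0// ltW.
have HB n : dos_idx m n -> Bfh n <= M / theta + 1.
  move=> Hn; apply: bigmax_nat_le => [|i /andP[li]].
    by rewrite (le_trans (ltW e1))// lerDr divr_ge0// ltW.
  rewrite ltnS => iN; have i2 : (2 <= i)%N by exact: leq_trans li.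
  have Hi : dos_idx m i by apply: dos_idxW Hn _; rewrite (ltnW i2).
  by rewrite ler_wpDr// ler_wpM2r ?HM// invr_ge0 ltW.
have g0 := lt_trans ltr01 gamma1_gt1.
exists (c / (gamma1 * (M / theta + 1))) => [|n Hn].
  by rewrite divr_gt0// mulr_gt0.
rewrite /step_bound; apply: ler_pM; first exact: ltW.
- by rewrite invr_ge0 mulr_ge0// ltW.
- by rewrite lerBrDl -lerBrDr; exact: Hc.
- by rewrite lef_pV2 ?posrE ?mulr_gt0 ?Bfh_gt0// ler_pM2l//; exact: HB.
Qed.

(** Both estimators are running maxima: the numerator can only decrease and the denominator only
    increase. *)
Lemma step_bound_noninc n n' : (n <= n')%N -> dos_idx m n' ->
  step_bound n' <= step_bound n.
Proof.
move=> nn' Hn'; have g0 := lt_trans ltr01 gamma1_gt1.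
rewrite /step_bound; apply: ler_pM.
- exact: ltW (Bdh_lt1 Hn').
- by rewrite invr_ge0 mulr_ge0// ltW.
- by rewrite lerD2l lerN2; exact: bigmax_nat_homo.
- by rewrite lef_pV2 ?posrE ?mulr_gt0 ?Bfh_gt0// ler_pM2l//; exact: bigmax_nat_homo.
Qed.

(* The attack-free time before the n-th attack. *)
Definition free_time n : R := h n - \sum_(1 <= i < n) tau i.

(** Keeping only the term [i = n] of each maximum, the numerator is at most
    [theta * (free_time n / h n)] and the denominator at least [gamma1 * (n%:R / h n / theta)];
    [h n] cancels. *)
Lemma step_bound_le_free n : (ell <= n)%N -> dos_idx m n ->
  step_bound n <= theta ^+ 2 / gamma1 * (free_time n / n%:R).
Proof.
move=> ln Hn; have n2 : (2 <= n)%N by exact: leq_trans ln.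
have /andP[th0 th1] := theta01; have g0 := lt_trans ltr01 gamma1_gt1.
have hn := h_gt0 dos n2 Hn; have tn := tau_ge0 dos Hn.
have nn : (0 : R) < n%:R by rewrite ltr0n ltnW.
have nin : n \in index_iota ell n.+1 by rewrite mem_index_iota ln leqnn.
have B1 : theta * Bd_i m h tau n + (1 - theta) <= Bdh n.
  exact: (le_bigmax_seq eps0 n xpredT (fun i => theta * Bd_i m h tau i + (1 - theta)) nin).
have B2 : n%:R / h n / theta <= Bfh n.
  exact: (le_bigmax_seq eps0 n xpredT (fun i => Bf_i h i / theta) nin).
have T0 : 0 < h n + tau n by rewrite ltr_wpDr.
(* The attacked time includes [tau n], which cancels the one in [h n + tau n] and leaves
   [free_time n]. *)
have B3 : 1 - Bd_i m h tau n <= free_time n / (h n + tau n).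
  rewrite ler_pdivlMr// mulrBl mul1r /Bd_i divfK ?gt_eqF//.
  have := sum_tau_le_Xi dos Hn; rewrite big_nat_recr ?(ltnW n2)//= /free_time; lra.
have F0 : 0 <= free_time n.
  have : 0 < 1 - Bdh n by exact: Bdh_lt1.
  move=> D1; have : 0 <= free_time n / (h n + tau n) by nra.
  by rewrite pmulr_lge0// invr_gt0.
have B4 : free_time n / (h n + tau n) <= free_time n / h n.
  by rewrite ler_wpM2l// lef_pV2 ?posrE// lerDl.
have B5 : 1 - Bdh n <= theta * (free_time n / h n) by nra.
apply: (@le_trans _ _ (theta * (free_time n / h n) / (gamma1 * (n%:R / h n / theta)))).
  rewrite /step_bound; apply: ler_pM => //.
  - exact: ltW (Bdh_lt1 Hn).
  - by rewrite invr_ge0 mulr_ge0// ltW.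
  - by rewrite lef_pV2 ?posrE ?mulr_gt0 ?invr_gt0// ?ler_pM2l//; exact: Bfh_gt0.
by rewrite le_eqVlt; apply/orP; left; apply/eqP; field; rewrite !gt_eqF.
Qed.

(** * Sampling times and the existence of late successful samples *)

Hypothesis Delta0_gt0 : 0 < Delta0.
Hypothesis t1 : t 1%N = 0.
Hypothesis tS : forall k, (1 <= k)%N -> t k.+1 = t k + Delta k.
Hypothesis Delta_init : forall k, (1 <= k)%N -> in_phase m h tau 0 (t k) -> Delta k = Delta0.
Hypothesis Delta_phase : forall k n, (1 <= k)%N -> (1 <= n)%N ->
  in_phase m h tau n (t k) -> Delta k = Num.min Delta0 (step_bound n).

Lemma in_phase_idx n s : (0 < n)%N -> in_phase m h tau n s ->
  dos_idx m n /\ h n + tau n <= s.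
Proof.
by case: n => // n _ [+ _]; rewrite /dos_end; case: ifP.
Qed.

Lemma in_phase_le n n' s s' : in_phase m h tau n s -> in_phase m h tau n' s' ->
  s <= s' -> (n <= n')%N.
Proof.
move=> pn [_ pn'] ss'; rewrite leqNgt; apply/negP => nn'.
have [Hn ens] := in_phase_idx (leq_ltn_trans (leq0n _) nn') pn.
have Hn' : dos_idx m n'.+1 by apply: dos_idxW Hn _; rewrite /= nn'.
move: pn'; rewrite /dos_end Hn' lte_fin ltNge => /negP; apply.
by apply: le_trans ss'; apply: le_trans ens; apply: (dos_end_le dos Hn); rewrite /= nn'.
Qed.

(** Phases exist only for nonnegative times, so the sign of [t k] and the bound on [Delta k] go
    through one induction. *)
Lemma Delta_ge : exists2 Dlow : R, 0 < Dlow &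
  forall k, (1 <= k)%N -> 0 <= t k /\ Dlow <= Delta k.
Proof.
have [c c0 Hc] := step_bound_inf.
have D0 : 0 < Num.min Delta0 c by rewrite lt_min Delta0_gt0.
exists (Num.min Delta0 c) => //.
have H k : (1 <= k)%N -> 0 <= t k -> Num.min Delta0 c <= Delta k.
  move=> k1 /(in_phase_exists dos not_edge)[[|n] pn].
    by rewrite (Delta_init k1 pn) ge_min lexx.
  rewrite (Delta_phase k1 _ pn)// le_min !ge_min lexx/=.
  by rewrite Hc ?orbT//; case: (in_phase_idx _ pn).
elim=> // -[_ _|k IH _]; first by rewrite t1; split => //; apply: H; rewrite // t1.
have [tk Dk] := IH isT; have tk' : 0 <= t k.+2.
  by rewrite tS// addr_ge0// (le_trans (ltW D0)).
by split => //; exact: H.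
Qed.

Lemma t_ge0 k : (1 <= k)%N -> 0 <= t k.
Proof. by have [D _ /[apply] -[]] := Delta_ge. Qed.

Lemma Delta_gt0 k : (1 <= k)%N -> 0 < Delta k.
Proof. by have [D D0 /[apply] -[_]] := Delta_ge; exact: lt_le_trans. Qed.

Lemma t_le i j : (1 <= i <= j)%N -> t i <= t j.
Proof.
move=> /andP[i1]; elim: j => [|j IH]; first by rewrite leqNgt i1.
rewrite leq_eqVlt => /predU1P[<-//|]; rewrite ltnS => ij.
have j1 := leq_trans i1 ij; apply: (le_trans (IH ij)).
by rewrite tS// lerDl ltW// Delta_gt0.
Qed.

Lemma t_unbounded (B : R) : exists2 K, (1 <= K)%N & forall k, (K <= k)%N -> B < t k.
Proof.
have [D D0 HD] := Delta_ge.
have lin k : k%:R * D <= t k.+1.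
  elim: k => [|k IH]; first by rewrite mul0r t1.
  by rewrite tS// -natr1 mulrDl mul1r lerD//; have [] := HD k.+1.
exists (Num.truncn (B / D)).+2 => // k Kk.
apply: lt_le_trans (t_le (i := (Num.truncn (B / D)).+2) _); last by rewrite Kk.
by apply: lt_le_trans (lin _); rewrite -ltr_pdivrMr// truncnS_gt.
Qed.

(** The phase number grows with time and the step bound decreases with it; phase 0 uses the largest
    step. *)
Lemma Delta_noninc i j : (1 <= i <= j)%N -> Delta j <= Delta i.
Proof.
move=> /[dup] /andP[i1 ij] /t_le tij; have j1 := leq_trans i1 ij.
have [n pn] := in_phase_exists dos not_edge (t_ge0 i1).
have [n' pn'] := in_phase_exists dos not_edge (t_ge0 j1).
have nn' := in_phase_le pn pn' tij.
case: n pn nn' => [|n] pn nn'.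
  rewrite (Delta_init i1 pn); case: n' pn' {nn'} => [|n'] pn'.
    by rewrite (Delta_init j1 pn').
  by rewrite (Delta_phase j1 _ pn')// ge_min lexx.
have n'0 : (0 < n')%N by exact: leq_trans nn'.
rewrite (Delta_phase i1 _ pn)// (Delta_phase j1 _ pn')//.
rewrite le_min !ge_min lexx/= step_bound_noninc ?orbT//.
by case: (in_phase_idx n'0 pn').
Qed.

Lemma Delta_le_Delta0 k : (1 <= k)%N -> Delta k <= Delta0.
Proof.
move=> k1; have [[|n] pn] := in_phase_exists dos not_edge (t_ge0 k1).
  by rewrite (Delta_init k1 pn).
by rewrite (Delta_phase k1 _ pn)// ge_min lexx.
Qed.

(** A sample taken after the [n]-th attack lies in a phase [n' >= n]. Hence the infimum of the steps
    lies below every [step_bound n]. *)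
Lemma exists_Delta_le_step_bound n : dos_idx m n ->
  exists2 k, (1 <= k)%N & Delta k <= step_bound n.
Proof.
move=> Hn; have n0 : (0 < n)%N by case/andP: Hn.
have [k k1 Hk] := t_unbounded (h n + tau n); exists k => //.
have ek := Hk k (leqnn k).
have [n' pn'] := in_phase_exists dos not_edge (t_ge0 k1).
have nn' : (n <= n')%N.
  rewrite leqNgt; apply/negP => n'n; have [_] := pn'.
  have Hn' : dos_idx m n'.+1 by apply: dos_idxW Hn _; rewrite /= n'n.
  rewrite /dos_end Hn' lte_fin ltNge => /negP; apply.
  by apply: le_trans (ltW ek); apply: (dos_end_le dos Hn); rewrite /= n'n.
have n'0 : (0 < n')%N by exact: leq_trans nn'.
rewrite (Delta_phase k1 n'0 pn') ge_min step_bound_noninc ?orbT//.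
by case: (in_phase_idx n'0 pn').
Qed.

(** Closing the interval treats attacks with [tau j = 0] like the others. *)
Lemma attack_setE s : attack_set m h tau s ->
  exists j, dos_idx m j /\ h j <= s <= h j + tau j.
Proof.
move=> [j [Hj [->|[hs sh]]]]; exists j; split => //.
  by rewrite lexx lerDl (tau_ge0 dos).
by rewrite hs ltW.
Qed.

(** The increase of free time is [h j' - (h j + tau j)] minus the durations of the attacks in
    between. *)
Lemma free_time_jump s s' j j' : dos_idx m j' -> (1 <= j < j')%N ->
  s <= h j + tau j -> h j' <= s' -> free_time j' <= free_time j + (s' - s).
Proof.
move=> Hj' /andP[j0 jj'] sj js; rewrite /free_time (big_cat_nat (n := j))//=; last exact: ltnW.
rewrite (big_ltn jj').
have : 0 <= \sum_(j.+1 <= i < j') tau i.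
  rewrite big_nat; apply: sumr_ge0 => i /andP[ji ij'].
  apply: (tau_ge0 dos); apply: dos_idxW Hj' _.
  by rewrite (leq_trans _ ji)//= ltnW.
lra.
Qed.

(* If every late sample were attacked, each step would jump over at least one
   attack-free gap, so the free time up to the j-th attack would grow at most
   like j times the limiting step; step_bound_le_free says that it grows faster
   by a factor gamma1 / theta ^ 2 > 1. *)
Lemma not_all_attacked K : (1 <= K)%N ->
  ~ (forall k, (K <= k)%N -> attack_set m h tau (t k)).
Proof.
move=> K1 att; pose S : set R := [set Delta k | k in [set k | (1 <= k)%N]].
have [D D0 HD] := Delta_ge.
have lbS : has_lbound S by exists D => _ [k /= k1 <-]; have [] := HD k k1.
have S0 : S !=set0 by exists (Delta 1), 1%N.
pose I := inf S.
have I0 : 0 < I.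
  by apply: lt_le_trans D0 _; apply: lb_le_inf => // _ [k /= k1 <-]; have [] := HD k k1.
have /andP[th0 th1] := theta01.
set q := theta ^+ 2 / gamma1.
have g0 := lt_trans ltr01 gamma1_gt1.
have q0 : 0 < q by rewrite divr_gt0 ?exprn_gt0.
have q1 : q < 1.
  rewrite ltr_pdivrMr// mul1r (le_lt_trans _ gamma1_gt1)//.
  by rewrite exprn_ile1// ltW.
have qV : 1 < q^-1 by rewrite -invr1 ltf_pV2 ?posrE.
(* Halfway between 1 and [q^-1]: [1 < r] yields a step below [r * I], and [r < q^-1] the final
   contradiction. *)
pose r := (1 + q^-1) / 2.
have : I < r * I by rewrite ltr_pMl// /r; lra.
move=> /(inf_lt S0)[_ [k1 /= k11 <-] Dk1].
pose k0 := maxn k1 K.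
have k01 : (1 <= k0)%N by rewrite leq_max k11.
have Dr k : (k0 <= k)%N -> Delta k <= r * I.
  move=> kk; apply: le_trans (ltW Dk1); apply: Delta_noninc.
  by rewrite k11 (leq_trans _ kk)// leq_maxl.
have idx k : (k0 <= k)%N -> exists j, dos_idx m j /\ h j <= t k <= h j + tau j.
  by move=> kk; apply/attack_setE/att; rewrite (leq_trans _ kk)// leq_maxr.
have rI : 0 < r * I by rewrite mulr_gt0// /r; lra.
have [j0 [Hj0 tj0]] := idx k0 (leqnn _).
have inv k : (k0 <= k)%N -> exists j, [/\ dos_idx m j, h j <= t k <= h j + tau j &
    free_time j <= free_time j0 + r * I * j%:R].
  elim: k => [|k IH]; first by rewrite leqNgt k01.
  rewrite leq_eqVlt => /predU1P[<-|].
    by exists j0; split => //; rewrite lerDl mulr_ge0// ltW.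
  rewrite ltnS => kk; have k1' : (1 <= k)%N by exact: leq_trans kk.
  have [j [Hj /andP[j1 j2] Fj]] := IH kk.
  have [j' [Hj' /andP[j1' j2']]] := idx k.+1 (leqW kk).
  exists j'; split => //; first by rewrite j1'.
  have jpos : (0 < j)%N by case/andP: Hj.
  have jpos' : (0 < j')%N by case/andP: Hj'.
  have tt : t k <= t k.+1 by apply: t_le; rewrite k1' leqnSn.
  (* Staying in the same attack changes nothing, moving to a later one costs one step of at most
     [r * I], and going back contradicts the order of the attacks. *)
  case: (ltngtP j j') => jj; last by rewrite -jj.
    have := free_time_jump Hj' _ j2 j1'; rewrite jpos jj => /(_ isT).
    rewrite tS// => Fj'; have := Dr k kk.
    have : r * I * (j%:R + 1) <= r * I * j'%:R.
      by rewrite ler_wpM2l ?(ltW rI)// natr1 ler_nat.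
    by move: Fj Fj'; lra.
  have := dos_end_lt dos (i := j') Hj; rewrite jpos' jj => /(_ isT); lra.
(* The inequalities [q^-1 * I * j <= free_time j <= free_time j0 + r * I * j] force [j <= C]. *)
pose C := free_time j0 / (I * (q^-1 - r)).
have qr : 0 < q^-1 - r by rewrite /r; lra.
pose J := maxn ell (Num.truncn C).+1.
have bnd j : dos_idx m j -> free_time j <= free_time j0 + r * I * j%:R -> (j < J.+1)%N.
  move=> Hj Fj; rewrite ltnS leqNgt; apply/negP => Jj.
  have lj : (ell <= j)%N by rewrite (leq_trans _ (ltnW Jj))// leq_maxl.
  have jp : (0 : R) < j%:R by rewrite ltr0n; case/andP: Hj.
  have [k kpos Dk] := exists_Delta_le_step_bound Hj.
  have IS : I <= Delta k by apply: ge_inf => //; exists k.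
  have := le_trans (le_trans IS Dk) (step_bound_le_free lj Hj).
  rewrite -/q mulrA ler_pdivlMr// -ler_pdivrMl// => IF.
  have : C < j%:R.
    apply: lt_le_trans (truncnS_gt C) _; rewrite ler_nat.
    by rewrite (leq_trans _ (ltnW Jj))// leq_maxr.
  by rewrite /C ltr_pdivrMr ?mulr_gt0//; move: IF Fj; lra.
(* Only attacks of index at most [J] can be hit, and this sum exceeds all their end points; yet the
   sampling times are unbounded. *)
have [K' K'1 HK'] := t_unbounded (\sum_(j < J.+1) `|h j + tau j|).
have [j [Hj /andP[_ tj] Fj]] := inv (maxn k0 K') (leq_maxl _ _).
have := HK' (maxn k0 K') (leq_maxr _ _).
rewrite ltNge => /negP; apply; apply: (le_trans tj).
rewrite (bigD1 (Ordinal (bnd j Hj Fj)))//= (le_trans (ler_norm _))// lerDl.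
exact: sumr_ge0.
Qed.

End Sampling.

(** * Decay of the disagreement and average consensus *)

(** While [V] stays above [e], each contraction removes at least [rho * e], and contractions recur
    forever. *)
Lemma frequently_contracting (R : realType) (V : nat -> R) (rho : R) : 0 < rho ->
  (forall k, (1 <= k)%N -> V k.+1 <= V k) ->
  (forall K, (1 <= K)%N -> exists2 k, (K <= k)%N & V k.+1 <= (1 - rho) * V k) ->
  forall e, 0 < e -> exists2 K, (1 <= K)%N & forall k, (K <= k)%N -> V k < e.
Proof.
move=> rho0 Vdec Vcon e e0.
have Vle i j : (1 <= i <= j)%N -> V j <= V i.
  move=> /andP[i1]; elim: j => [|j IH]; first by rewrite leqNgt i1.
  rewrite leq_eqVlt => /predU1P[<-//|]; rewrite ltnS => ij.
  by apply: le_trans (IH ij); exact/Vdec/(leq_trans i1).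
suff [K K1 VK] : exists2 K, (1 <= K)%N & V K < e.
  by exists K => // k Kk; apply: le_lt_trans VK; apply: Vle; rewrite K1.
apply: contrapT => noK.
have Vge k : (1 <= k)%N -> e <= V k.
  by move=> k1; rewrite leNgt; apply/negP => Vk; apply: noK; exists k.
have Vlin n : exists2 k, (1 <= k)%N & V k <= V 1%N - n%:R * (rho * e).
  elim: n => [|n [k k1 Vk]]; first by exists 1%N => //; rewrite mul0r subr0.
  have [j kj Vj] := Vcon k k1; exists j.+1 => //.
  have j1 := leq_trans k1 kj.
  have := Vle k j; rewrite k1 kj => /(_ isT) Vjk.
  have : rho * e <= rho * V j by rewrite ler_wpM2l ?(ltW rho0)// Vge.
  by move: Vk Vj Vjk; rewrite -natr1; lra.
have re : 0 < rho * e by rewrite mulr_gt0.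
have [k k1 Vk] := Vlin (Num.truncn (V 1%N / (rho * e))).+1.
have := truncnS_gt (V 1%N / (rho * e)); rewrite ltr_pdivrMr// => V1.
by have := Vge k k1; lra.
Qed.

Unset Implicit Arguments.

Theorem theorem3 (R : realType) (N : nat) (a : 'I_N -> 'I_N -> bool)
  (m : option nat) (h tau : nat -> R)
  (ell : nat) (eps0 theta gamma1 Delta0 lamN : R)
  (t Delta : nat -> R) (x : 'I_N -> R -> R) :
  (* network: symmetric adjacency, irreducible Laplacian *)
  (forall i j, a i j = a j i) ->
  mx_irreducible (laplacian R a) ->
  (* lamN = lambda_N(L), the largest eigenvalue of L *)
  eigenvalue (laplacian R a) lamN ->
  (forall mu, eigenvalue (laplacian R a) mu -> mu <= lamN) ->
  (* DoS sequence which is not an edge case *)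
  is_DoS m h tau -> ~ edge_case m h tau ->
  (* estimator parameters *)
  (2 <= ell)%N -> 0 < eps0 < 1 -> 0 < theta < 1 ->
  (* sampling parameters *)
  1 < gamma1 -> 0 < Delta0 -> `|1 - Delta0 * lamN| < 1 ->
  (* sampling times: t_1 = 0, t_{k+1} = t_k + Delta_k *)
  t 1%N = 0 ->
  (forall k, (1 <= k)%N -> t k.+1 = t k + Delta k) ->
  (forall k, (1 <= k)%N -> in_phase m h tau 0 (t k) -> Delta k = Delta0) ->
  (forall k n, (1 <= k)%N -> (1 <= n)%N -> in_phase m h tau n (t k) ->
     Delta k = Num.min Delta0
       ((1 - Bd_hat_at m h tau ell eps0 theta n) /
        (gamma1 * Bf_hat_at h ell eps0 theta n))) ->
  (* dynamics dot x_i = u_i with the sampled, DoS-affected input *)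
  (forall k, (1 <= k)%N -> forall i s, t k <= s <= t k.+1 ->
     x i s = x i (t k) + (s - t k) *
       (if `[< attack_set m h tau (t k) >] then 0
        else \sum_(j < N) (a i j)%:R * (x j (t k) - x i (t k)))) ->
  (forall i, (x i s - (\sum_(j < N) x j 0) / N%:R) @[s --> +oo] --> 0) /\
  (exists Dlow : R, 0 < Dlow /\ forall k, (1 <= k)%N -> Dlow <= Delta k).
Proof.
move=> a_sym a_irr _ lam_max dos not_edge ell2 eps01 theta01 gamma1_gt1 D00 D0lam.
move=> t1 tS Dinit Dphase xS.
have [Dlow Dlow0 HD] :=
  Delta_ge dos not_edge ell2 eps01 theta01 gamma1_gt1 D00 t1 tS Dinit Dphase.
split; last by exists Dlow; split => // k /HD[].
have tle := t_le dos not_edge ell2 eps01 theta01 gamma1_gt1 D00 t1 tS Dinit Dphase.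
have tunb := t_unbounded dos not_edge ell2 eps01 theta01 gamma1_gt1 D00 t1 tS Dinit Dphase.
have DD0 := Delta_le_Delta0 dos not_edge ell2 eps01 theta01 gamma1_gt1 D00 t1 tS Dinit Dphase.
have notatt := not_all_attacked dos not_edge ell2 eps01 theta01 gamma1_gt1 D00 t1 tS Dinit Dphase.
have [c c0 contr] := laplacian_contraction a_sym a_irr lam_max D00 D0lam.
move=> i; have N0 : (N%:R : R) != 0 by rewrite pnatr_eq0 -lt0n (leq_ltn_trans _ (ltn_ord i)).
set avg := _ / N%:R.
pose y s : 'rV[R]_N := \row_j (x j s - avg).
pose V s := dotp (y s) (y s).
(* The time for which the sampled control has acted since [t k]: none under attack. *)
pose act k s : R := if `[< attack_set m h tau (t k) >] then 0 else s - t k.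
have yS k s : (1 <= k)%N -> t k <= s <= t k.+1 ->
    y s = y (t k) - act k s *: (y (t k) *m laplacian R a).
  move=> k1 ks; apply/rowP => j; rewrite [RHS]mxE [X in _ + X]mxE [X in _ - X]mxE.
  rewrite (mul_laplacian a_sym) !mxE (xS k k1 j s ks) /act.
  under [in RHS]eq_bigr => l _ do rewrite mxE opprB addrA subrK.
  by case: ifP => _; ring.
(* Zero sum is what the contraction estimate requires; it holds at [t 1 = 0] by the choice of
   [avg]. *)
have y0 k : (1 <= k)%N -> \sum_j y (t k) 0 j = 0.
  elim: k => // -[_ _|k IH _].
    under eq_bigr do rewrite mxE.
    by rewrite t1 sumrB sumr_const card_ord -mulr_natr divfK// subrr.
  have tt : t k.+1 <= t k.+2 <= t k.+2 by rewrite lexx andbT tle/=.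
  rewrite (yS k.+1)//; under eq_bigr do rewrite mxE [X in _ + X]mxE [X in _ - X]mxE.
  by rewrite sumrB -mulr_sumr IH// (sum_mul_laplacian a_sym) mulr0 subr0.
have Vact k s : (1 <= k)%N -> t k <= s <= t k.+1 -> V s <= (1 - c * act k s) * V (t k).
  move=> k1 /[dup] ks /andP[k2 k3]; rewrite {1}/V (yS k s)//.
  apply: contr; first exact: y0.
  rewrite /act; case: ifP => _; first by rewrite lexx ltW.
  by rewrite subr_ge0 k2/=; have := DD0 k k1; move: k3; rewrite tS//; lra.
have Vle k s : (1 <= k)%N -> t k <= s <= t k.+1 -> V s <= V (t k).
  move=> k1 /[dup] /andP[ks _] /(Vact k s k1) /le_trans; apply.
  rewrite ler_piMl ?dotp_ge0// gerBl mulr_ge0 ?(ltW c0)// /act.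
  by case: ifP; rewrite ?subr_ge0.
have tk1 k : (1 <= k)%N -> t k <= t k.+1 <= t k.+1.
  by move=> k1; rewrite lexx andbT tle// k1/=.
apply/cvgr0Pnorm_lt => e e0.
have [K K1 VK] : exists2 K, (1 <= K)%N & forall k, (K <= k)%N -> V (t k) < e ^+ 2.
  apply: (@frequently_contracting _ (fun k => V (t k)) (c * Dlow)).
  - by rewrite mulr_gt0.
  - by move=> k k1; apply: Vle => //; exact: tk1.
  (* An unattacked sample after [K] contracts by [1 - c * Delta k <= 1 - c * Dlow]. *)
  - move=> K K1; apply: contrapT => noK; apply: (notatt K K1) => k Kk.
    apply: contrapT => natt; apply: noK; exists k => //.
    have k1 := leq_trans K1 Kk; have := Vact k _ k1 (tk1 k k1).
    rewrite /act asboolF// tS// addrAC subrr add0r => /le_trans; apply.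
    rewrite ler_wpM2r ?dotp_ge0// lerD2l lerN2 ler_wpM2l ?(ltW c0)//.
    by have [] := HD k k1.
  - by rewrite exprn_gt0.
exists (t K); split; first exact: num_real.
move=> s Ks.
(* The first sampling time after [s] closes the sampling interval containing [s], on which [V] stays
   below its initial value. *)
have ex : exists k, (0 < k)%N && (s < t k).
  by have [k k1 /(_ k (leqnn k)) sk] := tunb s; exists k; rewrite k1.
have [[//|k] /= sk kmin] := ex_minnP ex.
have Kk : (K <= k)%N.
  rewrite -ltnS ltnNge; apply/negP => kK; have : t k.+1 <= t K by rewrite tle.
  by move=> /(lt_le_trans sk)/(lt_trans Ks); rewrite ltxx.
have k1 := leq_trans K1 Kk.
have ks : t k <= s <= t k.+1.
  rewrite (ltW sk) andbT leNgt; apply/negP => sk'.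
  by have := kmin k; rewrite k1 sk' ltnn => /(_ isT).
rewrite -(@ltr_pXn2r _ 2)// ?nnegrE ?(ltW e0)// real_normK ?num_real//.
apply: le_lt_trans (VK k Kk); apply: le_trans (Vle k s k1 ks).
by have := sqr_coord_le (y s) i; rewrite mxE.
Qed.
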